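(* Let $L$ be a finite-dimensional solvable Lie algebra over a perfect field $F$. Then $L$ is minimal non-elementary if and only if one of the following holds: (i) $L = L^2 \rtimes Fx$ for some $x \in L$, where $L^2$ is abelian and $0 \neq \phi(L) = \mathrm{Asoc}\, L$ is the biggest ideal of $L$ properly contained in $L^2$ (that is, $\phi(L) = \mathrm{Asoc}\, L$ is a nonzero ideal of $L$ properly contained in $L^2$, and it contains every ideal of $L$ that is properly contained in $L^2$); or (ii) $L$ is the three-dimensional Heisenberg algebra.
   Context: $L^2 = [L,L]$ is the derived algebra of $L$. The notation $L = L^2 \rtimes Fx$ means that $L$ is the semidirect product of the ideal $L^2$ and the one-dimensional subalgebra $Fx$ (so $L$ is the vector space direct sum of $L^2$ and $Fx$, with $x \neq 0$). The abelian socle $\mathrm{Asoc}\, L$ is the sum of the minimal abelian ideals of $L$. The three-dimensional Heisenberg algebra over $F$ is the Lie algebra with basis $x,y,z$ and $[x,y]=z$, $[x,z]=[y,z]=0$. For a finite-dimensional Lie algebra $S$, the Frattini subalgebra is the intersection of the maximal (proper) subalgebras of $S$, and the Frattini ideal $\phi(S)$ is the largest ideal of $S$ contained in the Frattini subalgebra (with $\phi(0)=0$). A Lie algebra $L$ is called elementary if $\phi(S) = 0$ for every subalgebra $S$ of $L$ (including $S = L$). A Lie algebra $L$ is called minimal non-elementary if every proper subalgebra of $L$ is elementary but $L$ itself is not elementary. *)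

(* Defs.v *)
From HB Require Import structures.
From mathcomp Require Import all_boot all_order all_algebra.
From mathcomp Require Import separable.
From mathcomp Require Import boolp classical_sets.

Set Implicit Arguments.
Unset Strict Implicit.
Unset Printing Implicit Defensive.

Import GRing.Theory.
Local Open Scope ring_scope.

Reserved Notation "[lie u , v ]" (at level 0, format "[lie  u ,  v ]").

Definition perfect_field (F : fieldType) : Prop :=
  forall p : {poly F}, irreducible_poly p -> separable_poly p.

(* Finite-dimensional Lie algebras over a field; [x, x] = 0 is required as such
   so that characteristic 2 is covered. *)
HB.mixin Record Vector_isLieAlgebra (F : fieldType) L of Vector F L := {
  lie_bracket : L -> L -> L;
  lie_linear_r : forall x, linear (lie_bracket x);
  lie_linear_l : forall y, linear (lie_bracket^~ y);
  liexx : forall x, lie_bracket x x = 0;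
  lie_jacobi : forall x y z,
    lie_bracket x (lie_bracket y z) + lie_bracket y (lie_bracket z x)
      + lie_bracket z (lie_bracket x y) = 0
}.

#[short(type="lieAlgType")]
HB.structure Definition LieAlgebra (F : fieldType) :=
  { L of Vector_isLieAlgebra F L & Vector F L }.

Notation "[lie u , v ]" := (lie_bracket u v) : ring_scope.

Section Families.
Context {F : fieldType} {vT : vectType F}.
Implicit Types (P : set {vspace vT}) (U W : {vspace vT}).

(* Intersection of a possibly infinite family of subspaces (the whole space for
   the empty family); [capvsP] shows that the default value 0 is never used for
   want of a witness. *)
Definition capvs P : {vspace vT} :=
  xget 0%VS [set W : {vspace vT} |
    forall v, v \in W <-> (forall U, P U -> v \in U)]%classic.

Lemma capvsP P v : v \in capvs P <-> (forall U, P U -> v \in U).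
Proof.
suff exW : exists W : {vspace vT},
    forall v, v \in W <-> (forall U, P U -> v \in U).
  exact: (xgetPex 0%VS exW).
pose Q W := forall v, (forall U, P U -> v \in U) -> v \in W.
suff H : forall n W, (\dim W <= n)%N -> Q W -> exists W : {vspace vT},
    forall v, v \in W <-> (forall U, P U -> v \in U).
  by apply: (H _ fullv (leqnn _)) => u _; exact: memvf.
elim=> [|n IHn] W dimW QW;
  have [sW|/existsNP[U /not_implyP[PU /negP nWU]]] :=
    pselect (forall U, P U -> (W <= U)%VS).
- by exists W => u; split=> [uW U PU|]; [exact: (subvP (sW U PU))|exact: QW].
- case/negP: nWU; move: dimW; rewrite leqn0 dimv_eq0 => /eqP ->.
  exact: sub0v.
- by exists W => u; split=> [uW U PU|]; [exact: (subvP (sW U PU))|exact: QW].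
- apply: (IHn (W :&: U)%VS).
    rewrite -ltnS (leq_trans _ dimW) // ltn_neqAle dimvS ?capvSl // andbT.
    apply: contra nWU => /eqP dimE.
    have /eqP <- : (W :&: U == W)%VS by rewrite eqEdim capvSl dimE /=.
    exact: capvSr.
  by move=> u Hu; rewrite memv_cap QW //= Hu.
Qed.

(* Sum of a possibly infinite family of subspaces: the smallest subspace
   containing all the members. *)
Definition sumvs P : {vspace vT} :=
  capvs [set W : {vspace vT} | forall U, P U -> (U <= W)%VS]%classic.

Lemma sumvs_sup P U : P U -> (U <= sumvs P)%VS.
Proof.
by move=> PU; apply/subvP => v vU; apply/capvsP => W /(_ U PU)/subvP; apply.
Qed.

Lemma sumvs_sub P W : (forall U, P U -> (U <= W)%VS) -> (sumvs P <= W)%VS.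
Proof. by move=> sPW; apply/subvP => v /capvsP; apply. Qed.

End Families.

Section LieTheory.
Context {F : fieldType} {L : lieAlgType F}.
Implicit Types (S T U V W I J M : {vspace L}).

HB.instance Definition _ (x : L) :=
  GRing.isLinear.Build F L L *:%R (lie_bracket x) (lie_linear_r x).
Definition lie_bracketr (y x : L) : L := [lie x, y].
HB.instance Definition _ (y : L) :=
  GRing.isLinear.Build F L L *:%R (lie_bracketr y) (lie_linear_l y).

Definition liev U V : {vspace L} :=
  <<[seq [lie u, v] | u <- vbasis U, v <- vbasis V]>>%VS.

Lemma memv_lie U V : {in U & V, forall u v, [lie u, v] \in liev U V}.
Proof.
move=> u v /coord_vbasis-> /coord_vbasis->.
rewrite linear_sum; apply: memv_suml => j _.
rewrite linearZ memvZ //=.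
rewrite -/(lie_bracketr _ _) linear_sum.
apply: memv_suml => i _; rewrite linearZ memvZ // memv_span //.
by apply/allpairsP; exists ((vbasis U)`_i, (vbasis V)`_j); rewrite !memt_nth.
Qed.

Lemma lievP {U V W} :
  reflect {in U & V, forall u v, [lie u, v] \in W} (liev U V <= W)%VS.
Proof.
apply: (iffP idP) => [sUVW u v Uu Vv | sUVW].
  by rewrite (subvP sUVW) ?memv_lie.
apply/span_subvP=> _ /allpairsP[[u v] /= [Uu Vv ->]].
by rewrite sUVW ?vbasis_mem.
Qed.

Definition subalgebra S : bool := (liev S S <= S)%VS.

Definition ideal_of S I : bool := (I <= S)%VS && (liev S I <= I)%VS.

Definition ideal I : bool := ideal_of fullv I.

Definition abelian I : bool := liev I I == 0%VS.

Definition derived_algebra : {vspace L} := liev fullv fullv.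

Definition derived_series n : {vspace L} := iter n (fun U => liev U U) fullv.

Definition lie_solvable : Prop := exists n, derived_series n = 0%VS.

Definition semidirect I S : Prop :=
  [/\ ideal I, subalgebra S, (I + S)%VS = fullv & (I :&: S)%VS = 0%VS].

Definition maximal_subalgebra_of S M : Prop :=
  [/\ subalgebra M, (M <= S)%VS, M <> S
    & forall T, subalgebra T -> (M <= T)%VS -> (T <= S)%VS -> T = M \/ T = S].

(* The intersection with S only matters for S = 0, which has no maximal
   subalgebra. *)
Definition frattini_subalgebra S : {vspace L} :=
  (S :&: capvs (maximal_subalgebra_of S))%VS.

(* The largest ideal of S inside the Frattini subalgebra, obtained as the sum of
   all of them, see [frattini_idealP]. *)
Definition frattini_ideal S : {vspace L} :=
  sumvs (fun I => ideal_of S I /\ (I <= frattini_subalgebra S)%VS).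

Lemma frattini_idealP S :
  [/\ ideal_of S (frattini_ideal S),
      (frattini_ideal S <= frattini_subalgebra S)%VS
    & forall I, ideal_of S I -> (I <= frattini_subalgebra S)%VS ->
        (I <= frattini_ideal S)%VS].
Proof.
have sphi : (frattini_ideal S <= frattini_subalgebra S)%VS.
  by apply: sumvs_sub => I [].
split=> //; last by move=> I idI sI; apply: sumvs_sup.
apply/andP; split; first exact: subv_trans sphi (capvSl _ _).
apply/lievP => s v sS vphi.
suff /subvP/(_ v vphi) : (frattini_ideal S <=
    linfun (lie_bracket s) @^-1: frattini_ideal S)%VS.
  by rewrite -memv_preim lfunE.
apply: sumvs_sub => I [idI sI]; apply/subvP => u uI.
rewrite -memv_preim lfunE /=.
have /subvP -> // : (I <= frattini_ideal S)%VS by apply: sumvs_sup.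
by case/andP: idI => _ /lievP; apply.
Qed.

Definition minimal_ideal I : Prop :=
  [/\ ideal I, I <> 0%VS
    & forall J, ideal J -> (J <= I)%VS -> J = 0%VS \/ J = I].

Definition asoc : {vspace L} :=
  sumvs (fun I => minimal_ideal I /\ abelian I).

Definition elementary S : Prop :=
  forall T, subalgebra T -> (T <= S)%VS -> frattini_ideal T = 0%VS.

Definition minimal_non_elementary : Prop :=
  ~ elementary fullv /\
  (forall S, subalgebra S -> S <> fullv -> elementary S).

Definition heisenberg3 : Prop :=
  exists x y z : L, [/\ basis_of fullv [:: x; y; z],
    [lie x, y] = z, [lie x, z] = 0 & [lie y, z] = 0].

End LieTheory.

Arguments derived_algebra {F} L.
Arguments derived_series {F} L n.
Arguments lie_solvable {F} L.
Arguments asoc {F} L.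
Arguments minimal_non_elementary {F} L.
Arguments heisenberg3 {F} L.

(* Main.v *)
(* For the direct implication, let [L] be minimal non-elementary, so
   [frattini_ideal L <> 0] while [frattini_ideal S = 0] for every proper
   subalgebra [S].  If [A] is an abelian ideal and [A + Fx] is proper, then every
   [x]-invariant subspace of [A] has an invariant complement, so, the field being
   perfect, [ad x] is annihilated on [A] by a separable polynomial.  Such an
   operator [y] satisfies: if [[x, y]] commutes with [y], then [[x, y] = 0].
   Applied twice to the last three nonzero terms of the derived series, this
   forces [L^2] to be abelian.
   If [L = L^2 + Fx], then [ad x] is bijective on [L^2], and a proper ideal [I] of
   [L] inside [L^2] is semisimple because [I + Fx] is proper: this gives (i).
   Otherwise all the operators [ad x] are separable and commute on [L^2], so an
   averaging argument in the style of Maschke makes [L^2] completely reducible.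
   If some [ad x] is nonzero on [L^2], then [L] splits as [U + V] with
   [U = ker (ad x)^2] a proper subalgebra and [V] an ideal in [L^2], whence
   [frattini_ideal L = 0], a contradiction; so [L^2] is central, and any two
   non-commuting elements span a Heisenberg algebra, which must be [L].
   Conversely, in case (i) a proper subalgebra not contained in [L^2] is
   [V + Ft] with [V] an ideal of [L] inside the abelian socle, and it splits in
   the same way. *)
Require Import Defs.
From mathcomp Require Import all_boot all_order all_algebra.
From mathcomp Require Import separable boolp.

Set Implicit Arguments.
Unset Strict Implicit.
Unset Printing Implicit Defensive.

Import GRing.Theory.
Local Open Scope ring_scope.

(** * Operators annihilated by a separable polynomial *)

Section PolynomialAction.
Context {F : fieldType} {vT : vectType F}.
Implicit Types (f g : 'End(vT)) (p q r s : {poly F}) (A U W : {vspace vT}).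

Definition stable f W : bool := (f @: W <= W)%VS.

Lemma stableP {f W} : reflect {in W, forall v, f v \in W} (stable f W).
Proof.
apply: (iffP subvP) => [fW v vW | fW _ /memv_imgP[v vW ->]]; last exact: fW.
exact/fW/memv_img.
Qed.

(** The operator p(f), with powers written as iterated compositions so that the zero space is
    covered. *)
Definition pact f p : 'End(vT) :=
  \sum_(i < size p) p`_i *: iter i (comp_lfun f) \1%VF.

Lemma pact_widen f p n : (size p <= n)%N ->
  pact f p = \sum_(i < n) p`_i *: iter i (comp_lfun f) \1%VF.
Proof.
move=> le_pn; rewrite /pact.
rewrite (big_ord_widen _ (fun i => p`_i *: iter i (comp_lfun f) \1%VF) le_pn).
rewrite big_mkcond; apply: eq_bigr => i _; case: ltnP => // /leq_sizeP -> //.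
by rewrite scale0r.
Qed.

Lemma pactD f p q v : pact f (p + q) v = pact f p v + pact f q v.
Proof.
rewrite !(@pact_widen _ _ (maxn (size p) (size q))) ?size_polyD
  ?leq_maxl ?leq_maxr //.
rewrite -add_lfunE -big_split /=; congr (fun_of_lfun _ v).
by apply: eq_bigr => i _; rewrite coefD scalerDl.
Qed.

Lemma pactC f c v : pact f c%:P v = c *: v.
Proof.
rewrite (@pact_widen _ _ 1) ?size_polyC ?leq_b1 //.
by rewrite big_ord1 coefC scale_lfunE id_lfunE.
Qed.

Lemma pact0 f v : pact f 0 v = 0.
Proof. by rewrite -polyC0 pactC scale0r. Qed.

Lemma pact1 f v : pact f 1 v = v.
Proof. by rewrite -polyC1 pactC scale1r. Qed.

Lemma pactMX f p v : pact f (p * 'X) v = f (pact f p v).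
Proof.
rewrite (@pact_widen _ _ (size p).+1); last first.
  by rewrite (leq_trans (size_polyMleq _ _)) // size_polyX addn2.
rewrite big_ord_recl coefMX eqxx scale0r add0r /pact !sum_lfunE linear_sum.
by apply: eq_bigr => i _; rewrite coefMX !scale_lfunE linearZ /= comp_lfunE.
Qed.

Lemma pact_stable f p A : stable f A -> stable (pact f p) A.
Proof.
move=> /stableP fA; apply/stableP => v vA.
elim/poly_ind: p => [|p c IH]; first by rewrite pact0 mem0v.
by rewrite pactD pactMX pactC memvD ?fA ?memvZ.
Qed.

Lemma pact_comm f g p A : stable f A ->
  {in A, forall a, g (f a) = f (g a)} ->
  {in A, forall a, g (pact f p a) = pact f p (g a)}.
Proof.
move=> fA cfg a aA; elim/poly_ind: p => [|p c IH].
  by rewrite !pact0 linear0.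
rewrite !pactD !pactMX !pactC linearD linearZ /= -IH cfg //.
by apply: (stableP (pact_stable p fA)).
Qed.

Lemma pact_self f p v : pact f p (f v) = f (pact f p v).
Proof.
by have /(_ (fun _ _ => erefl) v (memvf v)) -> := @pact_comm f f p fullv (subvf _).
Qed.

Lemma pactM f p q v : pact f (p * q) v = pact f p (pact f q v).
Proof.
have pactZ c r u : pact f (c *: r) u = c *: pact f r u.
  elim/poly_ind: r => [|r d IH]; first by rewrite scaler0 !pact0 scaler0.
  rewrite scalerDr scalerAl !pactD !pactMX IH linearZ /= scalerDr.
  by rewrite -mul_polyC -polyCM !pactC scalerA.
elim/poly_ind: p => [|p c IH]; first by rewrite mul0r !pact0.
by rewrite mulrDl mulrAC !pactD !pactMX IH mul_polyC pactZ !pactC.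
Qed.

Definition separable_on f A : Prop :=
  exists2 p, separable_poly p & {in A, forall a, pact f p a = 0}.

(** The first [dim + 1] iterates of a vector are dependent, which gives a polynomial killing that
    vector. The product of these over a spanning family kills [A]. *)
Lemma annihilating_poly f A : stable f A ->
  exists2 p, p != 0 & {in A, forall a, pact f p a = 0}.
Proof.
move=> fA.
have [e sAe] : exists e : seq vT, (A <= <<e>>)%VS.
  by exists (vbasis A); rewrite (span_basis (vbasisP A)).
suff [p p0 pe] : exists2 p, p != 0 & {in e, forall a, pact f p a = 0}.
  exists p => // a /(subvP sAe) ae; apply/eqP; rewrite -memv_ker.
  move: a ae; apply/subvP/span_subvP => u /pe pu; by rewrite memv_ker pu.
elim: e {sAe} => [|u e [p p0 pe]]; first by exists 1; rewrite ?oner_eq0.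
have [q q0 qu] : exists2 q, q != 0 & pact f q u = 0.
  pose n := (\dim {:vT}).+1.
  pose X := [tuple (iter i (comp_lfun f) \1%VF) u | i < n].
  have /negP nfX : ~~ free X.
    rewrite /free size_tuple neq_ltn ltnS (leq_trans (dimvS (subvf _))) //.
  have /existsNP[k /not_implyP[k0 /existsNP[i /eqP ki]]] : ~ forall k : 'I_n -> F,
      \sum_(i < n) k i *: X`_i = 0 -> (forall i, k i = 0).
    by move=> H; apply: nfX; apply/freeP.
  exists (\poly_(i < n) k (inord i)).
    apply: contraNneq ki => q0; have /(congr1 (fun r : {poly F} => r`_i)) := q0.
    by rewrite coef_poly ltn_ord inord_val coef0 => ->.
  rewrite (@pact_widen _ _ n) ?size_poly // sum_lfunE -[RHS]k0.
  apply: eq_bigr => j _.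
  by rewrite coef_poly ltn_ord inord_val scale_lfunE -tnth_nth tnth_mktuple.
exists (p * q); first by rewrite mulf_neq0.
move=> a; rewrite in_cons => /predU1P[->|ae]; first by rewrite pactM qu linear0.
by rewrite mulrC pactM pe // linear0.
Qed.

(** * Separability from invariant complements *)

Lemma irreducible_factor p : (1 < size p)%N ->
  exists2 q, irreducible_poly q & q %| p.
Proof.
elim: {p}(size p) {-2}p (leqnn (size p)) => [p|n IH p] sp p1.
  by move: p1; rewrite ltnNge (leq_trans sp).
have [irrp|] := pselect (irreducible_poly p); first by exists p.
move=> /not_andP[//|/existsNP[q /not_implyP[q1 /not_implyP[qp /negP npq]]]].
have p0 : p != 0 by rewrite -size_poly_gt0 ltnW.
have q0 : q != 0 by apply: contraTneq qp => ->; rewrite dvd0p.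
have ltqp : (size q < size p)%N.
  by rewrite ltn_neqAle dvdp_leq // andbT (dvdp_size_eqp qp).
have [||r irr rq] := IH q; first by rewrite -ltnS (leq_trans ltqp).
  by rewrite ltn_neqAle eq_sym q1 size_poly_gt0.
by exists r => //; exact: dvdp_trans qp.
Qed.

(** Take [q] irreducible dividing gcd(p, p') and write p = r q. Then [q] divides r q'; by perfection
    it is prime to q', so it divides [r]. *)
Lemma perfect_square_factor p : perfect_field F -> p != 0 ->
  ~~ separable_poly p -> exists2 q, irreducible_poly q & q ^+ 2 %| p.
Proof.
move=> perfF p0 nsep.
have [|q irrq] := @irreducible_factor (gcdp p p^`()).
  rewrite ltn_neqAle eq_sym; move: nsep.
  rewrite separable_poly.unlock /coprimep => ->.
  by rewrite size_poly_gt0 gcdp_eq0 (negPf p0).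
rewrite dvdp_gcd => /andP[/dvdpP[r pE] qp']; exists q => //.
have : q %| r * q^`().
  by move: qp'; rewrite pE derivM dvdp_addr // dvdp_mull.
rewrite Gauss_dvdpl; last by have := perfF q irrq; rewrite separable_poly.unlock.
by rewrite pE expr2 dvdp_mul2r ?irredp_neq0.
Qed.

(** If the annihilator is p = s q^2, let [U] be a stable complement of the kernel [W] of q(f) in
    [A]. Then q s kills [W] and maps [U] into [U :&: W = 0], so it annihilates [A] with smaller
    degree. *)
Lemma separable_on_of_complements f A : perfect_field F -> stable f A ->
  (forall W, (W <= A)%VS -> stable f W ->
     exists U, [/\ stable f U, (W + U = A)%VS & (W :&: U = 0)%VS]) ->
  separable_on f A.
Proof.
move=> perfF fA compl; have [p p0 pA] := annihilating_poly fA.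
elim: {p}(size p) {-2}p (leqnn (size p)) p0 pA => [p|n IH p] sp p0 pA.
  by move: p0; rewrite -size_poly_gt0 ltnNge sp.
have [sepp|nsep] := boolP (separable_poly p); first by exists p.
have [q irrq /dvdpP[s pE]] := perfect_square_factor perfF p0 nsep.
have q0 := irredp_neq0 irrq.
have s0 : s != 0 by apply: contraNneq p0 => s0; rewrite pE s0 mul0r.
apply: (IH (q * s)); last first.
- pose W := (A :&: lker (pact f q))%VS.
  have fW : stable f W.
    apply/stableP => v; rewrite memv_cap memv_ker => /andP[vA /eqP qv].
    by rewrite memv_cap memv_ker (stableP fA) //= pact_self qv linear0.
  have [U [fU WUA WU0]] := compl W (capvSl _ _) fW.
  have UA : (U <= A)%VS by rewrite -WUA addvSr.
  move=> a; rewrite -WUA => /memv_addP[w wW [u uU ->]]; rewrite linearD /=.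
  move: wW; rewrite memv_cap memv_ker => /andP[_ /eqP qw].
  rewrite {1}mulrC pactM qw linear0 add0r.
  apply/eqP; rewrite -memv0 -WU0 !memv_cap memv_ker.
  have qsU := stableP (pact_stable (q * s) fU) _ uU.
  rewrite qsU andbT (subvP UA) //= -pactM mulrA -expr2 mulrC -pE pA //.
  exact: (subvP UA).
- by rewrite mulf_neq0.
rewrite -ltnS (leq_trans _ sp) // pE.
rewrite (_ : s * q ^+ 2 = q * (q * s)); last by rewrite mulrA -expr2 mulrC.
rewrite [X in (_ < X)%N]size_mul ?mulf_neq0 //.
have := irrq.1; case: (size q) => [|[|m]] // _; rewrite !addSn /=.
by rewrite ltnS leq_addl.
Qed.

(* With [D = [g, f]] commuting with [f], one gets [[g, p(f)] = p'(f) D]; if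
   [p(f) = 0] and [p] is separable, then [p'(f)] is invertible, whence [D = 0]. *)
Lemma separable_commutator0 f g A : separable_on f A ->
  stable f A -> stable g A ->
  (forall a, a \in A ->
     g (f (f a)) - f (g (f a)) = f (g (f a) - f (g a))) ->
  {in A, forall a, g (f a) = f (g a)}.
Proof.
move=> [p sepp pA] fA gA cD a aA.
pose D := (g \o f)%VF - (f \o g)%VF.
have DE v : D v = g (f v) - f (g v) by rewrite /D add_lfunE opp_lfunE !comp_lfunE.
have DA : stable D A.
  apply/stableP=> v vA; rewrite DE memvB //.
    by rewrite (stableP gA) ?(stableP fA).
  by rewrite (stableP fA) ?(stableP gA).
have Df q : {in A, forall v, D (pact f q v) = pact f q (D v)}.
  apply: pact_comm => // v vA; rewrite !DE; exact: cD.
have comm q : {in A, forall v,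
    g (pact f q v) - pact f q (g v) = pact f q^`() (D v)}.
  move=> v vA; elim/poly_ind: q => [|q c IH].
    by rewrite deriv0 !pact0 linear0 subr0.
  rewrite derivMXaddC !pactD !pactMX !pactC -IH linearD linearZ /= opprD.
  rewrite addrACA subrr addr0 -Df // DE linearB /=.
  by rewrite addrA subrK.
apply/eqP; rewrite -subr_eq0 -DE; apply/eqP.
have DaA := stableP DA _ aA.
have p'D : pact f p^`() (D a) = 0.
  by rewrite -comm // pA // linear0 pA ?subr0 // (stableP gA).
move: sepp; rewrite separable_poly.unlock.
case/Bezout_eq1_coprimepP => [[u v] /= uv1].
by rewrite -[LHS](pact1 f) -uv1 pactD !pactM p'D pA // !linear0 addr0.
Qed.

(** * Averaging of retractions *)

Definition retraction A W (pi : 'End(vT)) : Prop :=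
  {in A, forall a, pi a \in W} /\ {in W, forall w, pi w = w}.

(* [h] below is [(p(s) - p(t)) / (s - t)] applied to [pi], where [s] and [t] are
   the left and right multiplications by [f]; multiplying it by the inverse of
   [p'(f)] averages [pi] as in Maschke's theorem. *)
Lemma retraction_average f A W pi : (W <= A)%VS ->
    stable f A -> stable f W -> separable_on f A -> retraction A W pi ->
  exists2 pi', retraction A W pi' &
    {in A, forall a, pi' (f a) = f (pi' a)} /\
    (forall g, stable g A -> {in A, forall a, g (f a) = f (g a)} ->
       {in A, forall a, pi (g a) = g (pi a)} ->
       {in A, forall a, pi' (g a) = g (pi' a)}).
Proof.
move=> sWA fA fW [p sepp pA] [piW piid].
have WA := subvP sWA.
have [h [hW hid hf hg]] : exists h : 'End(vT),
  [/\ {in A, forall a, h a \in W}, {in W, forall w, h w = pact f p^`() w},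
      {in A, forall a, f (h a) - h (f a) = pact f p (pi a) - pi (pact f p a)}
    & forall g, stable g A -> {in A, forall a, g (f a) = f (g a)} ->
       {in A, forall a, pi (g a) = g (pi a)} ->
       {in A, forall a, h (g a) = g (h a)}].
  elim/poly_ind: p {sepp pA} => [|p c [h [hW hid hf hg]]].
    by exists 0; split=> [a aA|w wW|a aA|g gA gf gpi a aA];
      rewrite !zero_lfunE ?deriv0 ?pact0 ?mem0v ?linear0 ?subr0.
  (* Recursion for the divided difference: (s p(s) - t p(t)) / (s - t) = s (p(s) - p(t)) / (s - t) +
     p(t). *)
  exists ((f \o h)%VF + (pi \o pact f p)%VF);
    split=> [a aA|w wW|a aA|g gA gf gpi a aA].
  - rewrite add_lfunE !comp_lfunE memvD ?(stableP fW) ?hW //.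
    by rewrite piW // (stableP (pact_stable p fA)).
  - rewrite add_lfunE !comp_lfunE hid // piid ?(stableP (pact_stable p fW)) //.
    by rewrite derivMXaddC pactD pactMX addrC.
  - rewrite !add_lfunE !comp_lfunE !pactD !pactMX !pactC pact_self.
    rewrite !(linearD pi) linearZ (linearD f) !opprD addrACA -linearB hf //.
    by rewrite linearB addrA subrK [RHS]addrACA subrr addr0.
  - rewrite !add_lfunE !comp_lfunE hg // linearD /=; congr (_ + _).
      by rewrite gf // WA // hW.
    rewrite -(pact_comm p fA gf) // gpi //.
    exact: (stableP (pact_stable p fA)).
move: sepp; rewrite separable_poly.unlock.
case/Bezout_eq1_coprimepP => [[u v] /= uv1].
have hA a : a \in A -> h a \in A by move=> /hW/WA.
(* [v] inverts p' modulo [p], and p(f) vanishes on [A]: this restores the identity on [W], and [hf]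
   turns into commutation with [f]. *)
exists (pact f v \o h)%VF; split.
- by move=> a aA; rewrite comp_lfunE (stableP (pact_stable v fW)) ?hW.
- move=> w wW; rewrite comp_lfunE hid // -pactM -[RHS](pact1 f) -uv1 pactD.
  by rewrite (pactM f u) pA ?linear0 ?add0r ?WA.
- move=> a aA; rewrite !comp_lfunE -pact_self; congr (pact f v _).
  apply/esym/eqP; rewrite -subr_eq0 hf // (pA a) // linear0 subr0.
  by rewrite pA ?WA ?piW.
- move=> g gA gf gpi a aA; rewrite !comp_lfunE (hg g) //.
  by rewrite (pact_comm v fA gf) ?hA.
Qed.

(** Start from a projection onto [W] and average over one operator at a time; commutation with the
    operators already treated survives. The kernel of the final retraction in [A] is the
    complement. *)
Lemma commuting_separable_complement (fs : seq 'End(vT)) A W : (W <= A)%VS ->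
    {in fs, forall f, [/\ stable f A, stable f W & separable_on f A]} ->
    {in fs & fs, forall f g, {in A, forall a, f (g a) = g (f a)}} ->
  exists U, [/\ {in fs, forall f, stable f U}, (W + U = A)%VS
              & (W :&: U = 0)%VS].
Proof.
move=> sWA fsP fsC.
suff [pi [piW piid] pif] : exists2 pi, retraction A W pi &
    {in fs, forall f, {in A, forall a, pi (f a) = f (pi a)}}.
  exists (A :&: lker pi)%VS; split.
  - move=> f ff; apply/stableP => a; rewrite !memv_cap !memv_ker.
    case/andP=> aA /eqP pia; have [fA _ _] := fsP f ff.
    by rewrite (stableP fA) //= pif // pia linear0.
  - apply/vspaceP => a; apply/memv_addP/idP => [[w wW [u + ->]]|aA].
      by rewrite memv_cap => /andP[uA _]; rewrite memvD // (subvP sWA).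
    exists (pi a); first exact: piW.
    exists (a - pi a); last by rewrite addrC subrK.
    rewrite memv_cap memv_ker linearB /= (piid (pi a)) ?piW // subrr eqxx andbT.
    by rewrite memvB // (subvP sWA) ?piW.
  - apply/eqP; rewrite -subv0; apply/subvP => a; rewrite !memv_cap memv_ker memv0.
    by case/and3P=> aW _; rewrite piid.
suff H (gs : seq ('End(vT))) : {subset gs <= fs} -> exists2 pi, retraction A W pi &
    {in gs, forall f, {in A, forall a, pi (f a) = f (pi a)}} by exact: H.
elim: gs => [_|f gs IH sgs].
  by exists (projv W) => //; split=> [a _|w]; [exact: memv_proj|exact: projv_id].
have [|pi piP pig] := IH; first by move=> g gg; rewrite sgs // in_cons gg orbT.
have fin : f \in fs by rewrite sgs // mem_head.
have [fA fW sepf] := fsP f fin.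
have [pi' pi'P [pi'f pi'g]] := retraction_average sWA fA fW sepf piP.
exists pi' => // g; rewrite in_cons => /predU1P[->//|gg].
have gin : g \in fs by rewrite sgs // in_cons gg orbT.
by have [gA _ _] := fsP g gin; apply: pi'g; [|exact: fsC|exact: pig].
Qed.

End PolynomialAction.

(** * Subalgebras and ideals *)

Section LieBasics.
Context {F : fieldType} {L : lieAlgType F}.
Implicit Types (x y z : L) (S T U V W I J M A : {vspace L}).

Lemma lieDl x y z : [lie x + y, z] = [lie x, z] + [lie y, z].
Proof. exact: (linearD (lie_bracketr z)). Qed.

Lemma lieNl x y : [lie - x, y] = - [lie x, y].
Proof. exact: (linearN (lie_bracketr y)). Qed.

Lemma lieZl k x y : [lie k *: x, y] = k *: [lie x, y].
Proof. exact: (linearZ_LR (lie_bracketr y)). Qed.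

Lemma lie0l x : [lie 0, x] = 0.
Proof. exact: (linear0 (lie_bracketr x)). Qed.

Lemma lieDr x y z : [lie x, y + z] = [lie x, y] + [lie x, z].
Proof. exact: linearD. Qed.

Lemma lieZr k x y : [lie x, k *: y] = k *: [lie x, y].
Proof. exact: linearZ. Qed.

Lemma lie0r x : [lie x, 0] = 0.
Proof. exact: linear0. Qed.

Lemma lieC x y : [lie x, y] = - [lie y, x].
Proof.
have := liexx (x + y); rewrite lieDl !lieDr !liexx add0r addr0 => /eqP.
by rewrite addr_eq0 => /eqP.
Qed.

Lemma lie_leibniz x y z :
  [lie x, [lie y, z]] = [lie [lie x, y], z] + [lie y, [lie x, z]].
Proof.
have /eqP := lie_jacobi x y z; rewrite -addrA addr_eq0 => /eqP ->.
by rewrite opprD addrC [in X in X + _]lieC opprK (lieC z x) linearN opprK.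
Qed.

Definition ad x : 'End(L) := linfun (lie_bracket x).

Lemma adE x y : ad x y = [lie x, y].
Proof. exact: lfunE. Qed.

Lemma stable_adP x W : reflect {in W, forall w, [lie x, w] \in W} (stable (ad x) W).
Proof. by apply: (iffP stableP) => xW w /xW; rewrite adE. Qed.

Lemma ideal_ofP S I :
  reflect ((I <= S)%VS /\ {in S & I, forall s v, [lie s, v] \in I})
          (ideal_of S I).
Proof. by apply: (iffP andP) => -[? /lievP]. Qed.

Lemma abelianP I : reflect {in I &, forall u v, [lie u, v] = 0} (abelian I).
Proof.
rewrite /abelian -subv0; apply: (iffP lievP) => abI u v uI vI.
  by apply/eqP; rewrite -memv0 abI.
by rewrite memv0 abI.
Qed.

Lemma subalgebraP S : reflect {in S &, forall u v, [lie u, v] \in S} (subalgebra S).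
Proof. exact: lievP. Qed.

Lemma subalgebra_full : subalgebra (fullv : {vspace L}).
Proof. exact: subvf. Qed.

Lemma abelianS U V : (U <= V)%VS -> abelian V -> abelian U.
Proof.
move=> /subvP sUV /abelianP abV; apply/abelianP=> u v /sUV uV /sUV.
exact: abV.
Qed.

Lemma abelian_subalgebra U : abelian U -> subalgebra U.
Proof. by rewrite /subalgebra => /eqP ->; exact: sub0v. Qed.

Lemma abelian_line x : abelian <[x]>%VS.
Proof.
by apply/abelianP => _ _ /vlineP[a ->] /vlineP[b ->]; rewrite lieZl lieZr liexx !scaler0.
Qed.

Lemma ideal_of_sub S I : ideal_of S I -> (I <= S)%VS.
Proof. by case/ideal_ofP. Qed.

Lemma ideal_of_refl S : subalgebra S -> ideal_of S S.
Proof. by rewrite /ideal_of subvv. Qed.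

Lemma ideal_of0 S : ideal_of S 0.
Proof.
apply/ideal_ofP; split=> [|s v _]; first exact: sub0v.
by rewrite memv0 => /eqP ->; rewrite lie0r mem0v.
Qed.

Lemma ideal_ofD S I J : ideal_of S I -> ideal_of S J -> ideal_of S (I + J).
Proof.
move=> /ideal_ofP[sIS idI] /ideal_ofP[sJS idJ]; apply/ideal_ofP; split.
  by rewrite subv_add sIS.
move=> s _ sS /memv_addP[i iI [j jJ ->]].
by rewrite lieDr memv_add ?idI ?idJ.
Qed.

Lemma ideal_ofI S I J : ideal_of S I -> ideal_of S J -> ideal_of S (I :&: J).
Proof.
move=> /ideal_ofP[sIS idI] /ideal_ofP[sJS idJ]; apply/ideal_ofP; split.
  exact: subv_trans (capvSl _ _) sIS.
by move=> s v sS; rewrite !memv_cap => /andP[vI vJ]; rewrite idI ?idJ.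
Qed.

Lemma ideal_of_restr S T I :
  (T <= S)%VS -> (I <= T)%VS -> ideal_of S I -> ideal_of T I.
Proof.
move=> /subvP sTS sIT /ideal_ofP[_ idI]; apply/ideal_ofP; split=> // s v /sTS.
exact: idI.
Qed.

Lemma subalgebra_addI S T I : (T <= S)%VS -> subalgebra T -> ideal_of S I ->
  subalgebra (I + T).
Proof.
move=> /subvP sTS /subalgebraP saT /ideal_ofP[/subvP sIS idI].
apply/subalgebraP => _ _ /memv_addP[i iI [t tT ->]] /memv_addP[j jI [u uT ->]].
rewrite lieDl lieDr (lieDr t) addrA memv_add ?saT //.
by rewrite (lieC i u) memvD ?memvB ?idI ?(sTS t) ?(sTS u) ?(sIS i).
Qed.

Lemma subalgebra_cap S T : subalgebra S -> subalgebra T -> subalgebra (S :&: T).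
Proof.
move=> /subalgebraP saS /subalgebraP saT; apply/subalgebraP=> u v.
by rewrite !memv_cap => /andP[uS uT] /andP[vS vT]; rewrite saS ?saT.
Qed.

End LieBasics.

(** * Frattini ideals *)

Section Frattini.
Context {F : fieldType} {L : lieAlgType F}.
Implicit Types (x y z : L) (S T U V W I J M A : {vspace L}).

Lemma frattini_sub_max S M :
  maximal_subalgebra_of S M -> (frattini_subalgebra S <= M)%VS.
Proof.
move=> maxM; apply/subvP => v; rewrite memv_cap => /andP[_].
by move/capvsP; apply.
Qed.

Lemma sub_frattini S I : (I <= S)%VS ->
  (forall M, maximal_subalgebra_of S M -> (I <= M)%VS) ->
  (I <= frattini_subalgebra S)%VS.
Proof.
move=> sIS sIM; rewrite subv_cap sIS; apply/subvP => v vI; apply/capvsP => M maxM.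
exact: (subvP (sIM M maxM)).
Qed.

Lemma maximal_subalgebra_exists S T : subalgebra S -> subalgebra T ->
    (T <= S)%VS -> T <> S ->
  exists2 M, maximal_subalgebra_of S M & (T <= M)%VS.
Proof.
move=> saS; have [n] := ubnP (\dim S - \dim T)%N.
elim: n T => // n IH T dimT saT sTS nTS.
have [maxT|nmaxT] := pselect (maximal_subalgebra_of S T); first by exists T.
have [U [saU sTU sUS nUT nUS]] : exists U,
    [/\ subalgebra U, (T <= U)%VS, (U <= S)%VS, U <> T & U <> S].
  apply: contrapT => noU; apply: nmaxT; split=> // U saU sTU sUS.
  apply: contrapT => /not_orP[nUT nUS]; apply: noU; by exists U.
have [|M maxM sUM] := IH U _ saU sUS nUS; last first.
- by exists M => //; exact: subv_trans sUM.
have ltTU : (\dim T < \dim U)%N.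
  rewrite ltnNge; apply/negP => leUT; apply: nUT; apply/esym/eqP.
  by rewrite eqEdim sTU.
have ltTS := leq_trans ltTU (dimvS sUS).
by rewrite -ltnS (leq_trans _ dimT) // ltnS ltn_sub2l.
Qed.

(** Otherwise a maximal subalgebra containing [T] would also contain [I], hence [S]. *)
Lemma frattini_nongenerator S T I : subalgebra S -> subalgebra T ->
  (T <= S)%VS -> (I <= frattini_subalgebra S)%VS -> (S <= I + T)%VS -> T = S.
Proof.
move=> saS saT sTS sIF sSIT; apply: contrapT => nTS.
have [M maxM sTM] := maximal_subalgebra_exists saS saT sTS nTS.
have [_ sMS nMS _] := maxM; apply: nMS; apply/eqP; rewrite eqEsubv sMS /=.
rewrite (subv_trans sSIT) // subv_add sTM andbT.
exact: subv_trans sIF (frattini_sub_max maxM).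
Qed.

Lemma frattini_ideal_sub S : (frattini_ideal S <= frattini_subalgebra S)%VS.
Proof. by case: (frattini_idealP S). Qed.

Lemma frattini_idealW S : ideal_of S (frattini_ideal S).
Proof. by case: (frattini_idealP S). Qed.

Lemma sub_frattini_ideal S I : ideal_of S I -> (I <= frattini_subalgebra S)%VS ->
  (I <= frattini_ideal S)%VS.
Proof. by case: (frattini_idealP S) => _ _; apply. Qed.

(** The submodules of the [S]-module [V] are the ideals of [S] inside [V]. *)
Definition completely_reducible S V : Prop :=
  forall W, ideal_of S W -> (W <= V)%VS ->
    exists U, [/\ ideal_of S U, (W + U = V)%VS & (W :&: U = 0)%VS].

(** Shrink a supplement [C] of [W], starting from [S]. As [W] is abelian, [D = W :&: C] is an ideal
    of [S]; if it is nonzero, some maximal [M] does not contain it, so [D + M = S], and [M :&: C] is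
    a smaller supplement by the modular law. *)
Lemma abelian_ideal_complement S W : subalgebra S -> frattini_ideal S = 0%VS ->
    ideal_of S W -> abelian W ->
  exists C, [/\ subalgebra C, (C <= S)%VS, (W + C = S)%VS & (W :&: C = 0)%VS].
Proof.
move=> saS phi0 idW abW.
have [sWS idWS] := ideal_ofP _ _ idW.
suff H n C : (\dim C <= n)%N -> subalgebra C -> (C <= S)%VS -> (W + C = S)%VS ->
    exists C, [/\ subalgebra C, (C <= S)%VS, (W + C = S)%VS & (W :&: C = 0)%VS].
  by apply: (H _ S (leqnn _)) => //; apply/addv_idPr.
elim: n C => [|n IH] C dimC saC sCS WCS.
  exists C; split=> //; move: dimC; rewrite leqn0 dimv_eq0 => /eqP ->.
  exact: capv0.
pose D := (W :&: C)%VS.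
have idD : ideal_of S D.
  apply/ideal_ofP; split=> [|s v]; first exact: subv_trans (capvSl _ _) sWS.
  rewrite -WCS => /memv_addP[w wW [c cC ->]]; rewrite memv_cap => /andP[vW vC].
  rewrite lieDl (abelianP _ abW) // add0r memv_cap idWS ?(subvP sCS) //=.
  exact: (subalgebraP _ saC).
have [D0|D0] := eqVneq D 0%VS; first by exists C.
have /existsNP[M /not_implyP[maxM nDM]] :
    ~ forall M, maximal_subalgebra_of S M -> (D <= M)%VS.
  move=> DF; move/negP: D0; apply; rewrite -subv0 -phi0.
  by apply: sub_frattini_ideal => //; apply: sub_frattini => //; case/ideal_ofP: idD.
have [saM sMS nMS maxM'] := maxM.
have DMS : (D + M = S)%VS.
  have [||||//] := maxM' (D + M)%VS.
  - exact: subalgebra_addI saM idD.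
  - exact: addvSr.
  - by rewrite subv_add sMS andbT; case/ideal_ofP: idD.
  by move=> DM; case: nDM; rewrite -DM addvSl.
have sDC : (D <= C)%VS by exact: capvSr.
have CE : (D + (M :&: C) = C)%VS by rewrite vspace_modl // DMS; apply/capv_idPr.
apply: (IH (M :&: C)%VS).
- rewrite -ltnS (leq_trans _ dimC) // ltnNge; apply/negP => dimCM; apply: nDM.
  suff : (C <= M)%VS by exact: subv_trans.
  by have /eqP <- : (M :&: C == C)%VS; rewrite ?capvSl // eqEdim capvSr.
- exact: subalgebra_cap.
- exact: subv_trans (capvSr _ _) sCS.
rewrite -[RHS]WCS -{2}CE addvA; congr (_ + _)%VS.
by apply/esym/addv_idPl; exact: capvSl.
Qed.

(** If the subalgebra [C] complements [W] in [S], then [C :&: A] is an ideal because [W] acts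
    trivially on [A]. *)
Lemma completely_reducible_abelian_ideal S A : subalgebra S ->
  frattini_ideal S = 0%VS -> ideal_of S A -> abelian A -> completely_reducible S A.
Proof.
move=> saS phi0 idA abA W idW sWA.
have [C [saC sCS WCS WC0]] := abelian_ideal_complement saS phi0 idW (abelianS sWA abA).
have [sAS idAS] := ideal_ofP _ _ idA.
exists (C :&: A)%VS; split.
- apply/ideal_ofP; split=> [|s v]; first exact: subv_trans (capvSr _ _) sAS.
  rewrite -WCS => /memv_addP[w wW [c cC ->]]; rewrite memv_cap => /andP[vC vA].
  rewrite lieDl (abelianP _ abA) ?(subvP sWA w) // add0r memv_cap.
  by rewrite (subalgebraP _ saC) // idAS // (subvP sCS).
- by rewrite vspace_modl // WCS; apply/capv_idPr.
by rewrite capvA WC0 cap0v.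
Qed.

(** First [phi] meets [V] trivially, being made of non-generators; then its projection to [U] along
    [V] lies in the Frattini ideal of [U], so [phi] lies in [V]. *)
Lemma frattini_ideal_split S U V : subalgebra S -> subalgebra U -> ideal_of S V ->
    (U + V = S)%VS -> (U :&: V = 0)%VS -> frattini_ideal U = 0%VS ->
  completely_reducible S V -> frattini_ideal S = 0%VS.
Proof.
move=> saS saU idV UVS UV0 phiU crV.
have sUS : (U <= S)%VS by rewrite -UVS addvSl.
pose phi := frattini_ideal S.
have idphi : ideal_of S phi := frattini_idealW S.
have [W' [idW' WW' WW'0]] : exists W', [/\ ideal_of S W',
    (phi :&: V + W' = V)%VS & (phi :&: V :&: W' = 0)%VS].
  by apply: crV; [exact: ideal_ofI|exact: capvSr].
have phiV0 : (phi :&: V = 0)%VS.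
  (* [W' + U] together with [phi :&: V] spans [S], so it is already [S]. *)
  have W'US : (W' + U = S)%VS.
    apply: (@frattini_nongenerator _ _ (phi :&: V)) => //.
    - exact: subalgebra_addI saU idW'.
    - by rewrite subv_add sUS andbT; exact: ideal_of_sub.
    - exact: subv_trans (capvSl _ _) (frattini_ideal_sub S).
    by rewrite addvA WW' addvC UVS.
  have W'V : W' = V.
    have sW'V : (W' <= V)%VS by rewrite -WW' addvSr.
    have := vspace_modl U sW'V; rewrite UV0 addv0 W'US => ->.
    by apply/capv_idPr; exact: ideal_of_sub.
  by rewrite W'V -capvA capvv in WW'0.
have N0 : ((phi + V) :&: U = 0)%VS.
  apply/eqP; rewrite -subv0 -phiU; apply: sub_frattini_ideal.
    apply/ideal_ofP; split=> [|u v uU]; first exact: capvSr.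
    have /ideal_ofP[_ idphiV] := ideal_ofD idphi idV.
    rewrite !memv_cap => /andP[vphi vU].
    by rewrite idphiV ?(subvP sUS) // (subalgebraP _ saU).
  apply: sub_frattini => [|M [saM sMU nMU maxM]]; first exact: capvSr.
  have sMS := subv_trans sMU sUS.
  have VMU : ((V + M) :&: U = M)%VS.
    by rewrite addvC -vspace_modl // capvC UV0 addv0.
  (* Adding [V] sends maximal subalgebras of [U] to maximal subalgebras of [S]; intersecting with
     [U] recovers them. *)
  have saVM := subalgebra_addI sMS saM idV.
  suff maxVM : maximal_subalgebra_of S (V + M)%VS.
    rewrite -[X in (_ <= X)%VS]VMU capvS // subv_add addvSl andbT.
    exact: subv_trans (frattini_ideal_sub S) (frattini_sub_max maxVM).
  split=> //; first by rewrite subv_add sMS andbT; exact: ideal_of_sub.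
    by move=> VMS; apply: nMU; rewrite -VMU VMS; apply/capv_idPr.
  move=> T saT; rewrite subv_add => /andP[sVT sMT] sTS.
  have TE : (V + (U :&: T) = T)%VS.
    by rewrite vspace_modl // addvC UVS; apply/capv_idPr.
  have [|||TM|TU] := maxM (U :&: T)%VS.
  - exact: subalgebra_cap.
  - by rewrite subv_cap sMU.
  - exact: capvSl.
  - by left; rewrite -TE TM.
  by right; rewrite -TE TU addvC.
have : (phi + V <= V)%VS.
  rewrite -[X in (_ <= X)%VS]addv0 -N0 capvC vspace_modl ?addvSr //.
  by rewrite addvC [(V + U)%VS]addvC UVS subv_cap subvv andbT subv_add !ideal_of_sub.
rewrite subv_add => /andP[sphiV _].
by rewrite -[RHS]phiV0; apply/esym/capv_idPl.
Qed.

Lemma abelian_frattini_ideal0 S : abelian S -> frattini_ideal S = 0%VS.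
Proof.
move=> abS; have saS := abelian_subalgebra abS.
apply: (@frattini_ideal_split _ 0 S) => //.
- by apply/subalgebraP => u v; rewrite !memv0 => /eqP -> _; rewrite lie0l.
- exact: ideal_of_refl.
- exact: add0v.
- exact: cap0v.
- by apply/eqP; rewrite -subv0; exact: ideal_of_sub (frattini_idealW _).
move=> W idW sWS; exists (S :\: W)%VS; split.
- apply/ideal_ofP; split=> [|s v sS /(subvP (diffvSl _ _)) vS].
    exact: diffvSl.
  by rewrite (abelianP _ abS) ?mem0v.
- by rewrite addvC addv_diff; apply/addv_idPl.
by rewrite capvC capv_diff.
Qed.

(* If a maximal subalgebra [M] misses the central ideal [S, S], then
   [S = M + [S, S]], so [[S, S] = [M, M]] lies in [M] after all. *)
Lemma class2_frattini_ideal_neq0 S : subalgebra S ->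
  {in S & &, forall x y z, [lie x, [lie y, z]] = 0} -> ~~ abelian S ->
  frattini_ideal S <> 0%VS.
Proof.
move=> saS cl2 nab phi0; case/negP: nab; rewrite /abelian -subv0 -phi0.
have idD : ideal_of S (liev S S).
  apply/ideal_ofP; split=> // s v sS vD.
  suff /subvP/(_ v vD) : (liev S S <= lker (ad s))%VS.
    by rewrite memv_ker adE => /eqP ->; exact: mem0v.
  by apply/lievP => x y xS yS; rewrite memv_ker adE cl2.
apply: sub_frattini_ideal => //.
apply: sub_frattini => // M [saM sMS nMS maxM].
have DC : {in S & liev S S, forall s d, [lie s, d] = 0}.
  move=> s d sS dD; have /subvP/(_ d dD) : (liev S S <= lker (ad s))%VS.
    by apply/lievP => x y xS yS; rewrite memv_ker adE cl2.
  by rewrite memv_ker adE => /eqP.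
have [|||DM|DM] := maxM (liev S S + M)%VS.
- exact: subalgebra_addI saM idD.
- exact: addvSr.
- by rewrite subv_add sMS andbT.
- by rewrite -DM addvSl.
apply/lievP => u v; rewrite -{1 2}DM.
move=> /memv_addP[d dD [m mM ->]] /memv_addP[e eD [n nM ->]].
have dS := subvP saS _ dD; have nS := subvP sMS _ nM; have mS := subvP sMS _ mM.
rewrite lieDr (DC _ e (memvD dS mS) eD) add0r lieDl (lieC d) DC // oppr0 add0r.
exact: (subalgebraP _ saM).
Qed.

End Frattini.

(** * The derived algebra is abelian *)

Section Structure.
Context {F : fieldType} {L : lieAlgType F}.
Implicit Types (x y z : L) (S T U V W I J M N A B C : {vspace L}).

Lemma liev_cent A S :
  {in S &, forall x y, {in A, forall a, [lie [lie x, y], a] = 0}} ->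
  {in liev S S & A, forall b a, [lie b, a] = 0}.
Proof.
move=> SA b a bS aA; suff /subvP/(_ b bS) : (liev S S <= lker (ad a))%VS.
  by rewrite memv_ker adE lieC oppr_eq0 => /eqP.
by apply/lievP=> x y xS yS; rewrite memv_ker adE lieC SA ?oppr0.
Qed.

Lemma ideal_of_lie S I : ideal_of S I -> ideal_of S (liev I I).
Proof.
case/ideal_ofP=> sIS idI; apply/ideal_ofP; split.
  by apply: subv_trans (sIS); apply/lievP=> x y /(subvP sIS); exact: idI.
move=> s v sS vD; suff /subvP/(_ v vD) : (liev I I <= ad s @^-1: liev I I)%VS.
  by rewrite -memv_preim adE.
apply/lievP=> x y xI yI; rewrite -memv_preim adE lie_leibniz.
by rewrite memvD ?memv_lie ?idI.
Qed.

(** Used mainly when [A + <[x]>] is the whole algebra, to bound the derived algebra by the image of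
    [A] under [ad x]. *)
Lemma liev_sub_abelian_line A x : abelian A -> stable (ad x) A ->
  (liev (A + <[x]>) (A + <[x]>) <= ad x @: A)%VS.
Proof.
move=> /abelianP abA xA; apply/lievP.
move=> _ y /memv_addP[a aA [_ /vlineP[c ->] ->]].
case/memv_addP=> b bA [_ /vlineP[d ->] ->].
have -> : [lie a + c *: x, b + d *: x] = ad x (c *: b - d *: a).
  rewrite linearB !linearZ /= !adE lieDl !lieDr abA // add0r !lieZl !lieZr.
  by rewrite liexx !scaler0 addr0 (lieC a) scalerN addrC.
by rewrite memv_img // memvB ?memvZ.
Qed.

Section LineExtension.
Variables (A : {vspace L}) (x : L).
Hypotheses (abA : abelian A) (xA : stable (ad x) A).

Lemma subalgebra_line : subalgebra (A + <[x]>).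
Proof.
rewrite /subalgebra (subv_trans (liev_sub_abelian_line abA xA)) //.
exact: subv_trans xA (addvSl _ _).
Qed.

Lemma ideal_of_line W : (W <= A)%VS -> stable (ad x) W -> ideal_of (A + <[x]>) W.
Proof.
move=> sWA /stable_adP xW; apply/ideal_ofP; split.
  exact: subv_trans (addvSl _ _).
move=> _ w /memv_addP[a aA [_ /vlineP[c ->] ->]] wW.
by rewrite lieDl (abelianP _ abA a w aA) ?(subvP sWA) // add0r lieZl memvZ ?xW.
Qed.

End LineExtension.

Lemma ideal_of_stable S I x : ideal_of S I -> x \in S -> stable (ad x) I.
Proof. by case/ideal_ofP=> _ idI xS; apply/stable_adP=> v; exact: idI. Qed.

Lemma completely_reducibleS S V W : completely_reducible S V ->
  ideal_of S W -> (W <= V)%VS -> completely_reducible S W.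
Proof.
move=> crV idW sWV I idI sIW; have [U [idU IUV IU0]] := crV I idI (subv_trans sIW sWV).
exists (U :&: W)%VS; split; first exact: ideal_ofI.
  by rewrite vspace_modl // IUV; apply/capv_idPr.
by rewrite capvA IU0 cap0v.
Qed.

(** Inside the abelian [A], the stable subspaces of [ad x] are the ideals of [A + <[x]>], and these
    have complements. *)
Lemma separable_ad A x : perfect_field F -> abelian A -> stable (ad x) A ->
  frattini_ideal (A + <[x]>) = 0%VS -> separable_on (ad x) A.
Proof.
move=> perfF abA xA phi0; apply: separable_on_of_complements => // W sWA xW.
have saT := subalgebra_line abA xA.
have [||U [idU WUA WU0]] := completely_reducible_abelian_ideal saT phi0
    (ideal_of_line abA (subvv A) xA) abA (W := W).
- exact: ideal_of_line.
- by [].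
exists U; split=> //; apply: ideal_of_stable idU _.
by rewrite (subvP (addvSr _ _)) ?memv_line.
Qed.

(** This is [separable_commutator0] for [ad y] and [ad x], whose commutator is [ad [lie x, y]]. *)
Lemma separable_ad_bracket0 A x y : separable_on (ad y) A ->
    stable (ad y) A -> stable (ad x) A ->
    {in A, forall a, [lie [lie [lie x, y], y], a] = 0} ->
  {in A, forall a, [lie [lie x, y], a] = 0}.
Proof.
move=> sepy yA xA xyy a aA.
suff /(_ a aA) : {in A, forall a, ad x (ad y a) = ad y (ad x a)}.
  by rewrite !adE lie_leibniz => /eqP; rewrite -subr_eq0 addrK => /eqP.
apply: separable_commutator0 => // b bA; rewrite !adE.
rewrite [[lie x, [lie y, [lie y, b]]]]lie_leibniz addrK.
by rewrite [[lie x, [lie y, b]]]lie_leibniz addrK lie_leibniz xyy // add0r.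
Qed.

(** * Descent along the derived series *)

Section ProperFrattiniFree.
Hypothesis perfF : perfect_field F.
Hypothesis phi0 : forall S, subalgebra S -> S <> fullv -> frattini_ideal S = 0%VS.

(** If [B] is not abelian, each [A + <[c]>] is proper, so [ad c] is separable on [A]. Two uses of
    the commutator argument make [B] centralize [A = [B, B]]; then [B] is a proper non-abelian
    subalgebra of class 2, with nonzero Frattini ideal. *)
Lemma metabelian_derived_abelian C : subalgebra C ->
  abelian (liev (liev C C) (liev C C)) -> abelian (liev C C).
Proof.
move=> saC; set B := liev C C; set A := liev B B => abA.
have [//|/negP nabB] := boolP (abelian B).
have idB : ideal_of C B by apply: ideal_of_lie; exact: ideal_of_refl.
have idA : ideal_of C A by exact: ideal_of_lie.
have cA c : c \in C -> stable (ad c) A by exact: ideal_of_stable.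
have sepC c : c \in C -> separable_on (ad c) A.
  move=> cC; apply: separable_ad => //; first exact: cA.
  apply: phi0; first exact: subalgebra_line (cA c cC).
  move=> AcL; apply: nabB; apply: abelianS (abA).
  apply: subv_trans (cA c cC); apply: subv_trans (liev_sub_abelian_line abA (cA c cC)).
  by rewrite AcL; apply/lievP=> u v _ _; rewrite memv_lie ?memvf.
(* Here [[lie [lie c, b], b]] lies in [A], which acts trivially on itself. *)
have CB0 : {in C & B, forall c b, {in A, forall a, [lie [lie c, b], a] = 0}}.
  move=> c b cC bB; have bC := subvP (ideal_of_sub idB) _ bB.
  apply: separable_ad_bracket0; [exact: sepC|exact: cA|exact: cA|].
  move=> a aA; apply: (abelianP _ abA) => //; apply: memv_lie => //.
  exact: memv_lie.
(* Now [[lie c, d]] is in [B], so [CB0] disposes of its bracket with [d]. *)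
have BA0 : {in B & A, forall b a, [lie b, a] = 0}.
  apply: liev_cent => c d cC dC.
  apply: separable_ad_bracket0; [exact: sepC|exact: cA|exact: cA|].
  by move=> a aA; rewrite (lieC [lie c, d] d) lieNl CB0 ?oppr0 // memv_lie.
exfalso.
have saB : subalgebra B.
  by apply/lievP=> u v uB vB; apply: memv_lie; apply: (subvP (ideal_of_sub idB)).
have nBL : B <> fullv.
  move=> BL; apply: nabB; apply: abelianS (abA).
  by apply/lievP=> u v _ _; apply: memv_lie; rewrite BL memvf.
apply: class2_frattini_ideal_neq0 saB _ _ (phi0 saB nBL); last exact/negP.
by move=> u v w uB vB wB; rewrite BA0 // memv_lie.
Qed.

Lemma derived_algebra_abelian : lie_solvable L -> abelian (derived_algebra L).
Proof.
have idD n : ideal (derived_series L n).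
  elim: n => [|n IH]; first exact: ideal_of_refl subalgebra_full.
  exact: ideal_of_lie.
have saD n : subalgebra (derived_series L n).
  apply/subalgebraP=> u v _ vD; have /ideal_ofP[_] := idD n; apply=> //; exact: memvf.
have DS n : derived_series L n = 0%VS -> derived_series L n.+1 = 0%VS.
  by move=> D0; apply/eqP; rewrite -subv0 -[X in (_ <= X)%VS]D0; exact: saD.
case=> n.
(* The second term vanishes exactly when the derived algebra is abelian. The shift by 2 lets the
   induction apply the previous lemma to the term of index [m]. *)
suff : forall n, derived_series L n.+2 = 0%VS -> derived_series L 2 = 0%VS.
  by move=> H D0; apply/eqP; exact: (H n (DS _ (DS _ D0))).
elim=> // m IH D0; apply: IH.
by apply/eqP; apply: (metabelian_derived_abelian (saD m)); apply/eqP.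
Qed.

End ProperFrattiniFree.

End Structure.

(** * The abelian socle *)

Section Asoc.
Context {F : fieldType} {L : lieAlgType F}.
Implicit Types (x y z : L) (S T U V W I J M N A B C : {vspace L}).

Lemma asoc_ideal : ideal (asoc L).
Proof.
apply/ideal_ofP; split=> [|s v _ vA]; first exact: subvf.
suff /subvP/(_ v vA) : (asoc L <= ad s @^-1: asoc L)%VS.
  by rewrite -memv_preim adE.
apply: sumvs_sub => I minI; apply/subvP=> u uI; rewrite -memv_preim adE.
have /subvP : (I <= asoc L)%VS by exact: sumvs_sup.
apply; have [[/ideal_ofP[_ idI] _ _] _] := minI; apply: idI => //.
exact: memvf.
Qed.

Lemma minimal_ideal_exists I : ideal I -> I <> 0%VS ->
  exists2 N, minimal_ideal N & (N <= I)%VS.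
Proof.
have [n] := ubnP (\dim I); elim: n I => // n IH I dimI idI I0.
have [minI|nminI] := pselect (minimal_ideal I); first by exists I.
have [J [idJ sJI J0 nJI]] : exists J,
    [/\ ideal J, (J <= I)%VS, J <> 0%VS & J <> I].
  apply: contrapT => noJ; apply: nminI; split=> // J idJ sJI.
  by apply: contrapT => /not_orP[J0 nJI]; apply: noJ; exists J.
have [|N minN sNJ] := IH J _ idJ J0; last by exists N => //; exact: subv_trans sJI.
rewrite -ltnS (leq_trans _ dimI) // ltnS ltnNge; apply/negP => dimIJ.
by apply: nJI; apply/eqP; rewrite eqEdim sJI.
Qed.

(** A nonzero complement of [asoc L :&: I] in [I] would contain a minimal ideal, which is abelian
    and hence in the socle. *)
Lemma completely_reducible_sub_asoc I : ideal I -> abelian I ->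
  completely_reducible fullv I -> (I <= asoc L)%VS.
Proof.
move=> idI abI crI.
have [||U [idU SUI SU0]] := crI (asoc L :&: I)%VS.
- exact: ideal_ofI asoc_ideal idI.
- exact: capvSr.
have [U0|/eqP U0] := eqVneq U 0%VS.
  by rewrite -SUI U0 addv0 capvSl.
have sUI : (U <= I)%VS by rewrite -SUI addvSr.
have [N minN sNU] := minimal_ideal_exists idU U0.
have sNI := subv_trans sNU sUI.
have sNA : (N <= asoc L)%VS by apply: sumvs_sup; split=> //; exact: abelianS abI.
have [_ N0 _] := minN; case: N0; apply/eqP; rewrite -subv0 -SU0.
by rewrite !subv_cap sNA sNI sNU.
Qed.

(** Grow [U] by minimal abelian ideals not contained in [W + U]: by minimality such an ideal meets
    [W + U] trivially. *)
Lemma asoc_completely_reducible : completely_reducible fullv (asoc L).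
Proof.
move=> W idW sWA.
suff H n U : (\dim (asoc L) - \dim U < n)%N -> ideal U -> (U <= asoc L)%VS ->
    (W :&: U = 0)%VS ->
  exists U, [/\ ideal_of fullv U, (W + U = asoc L)%VS & (W :&: U = 0)%VS].
  apply: (H _ 0%VS (ltnSn _)); rewrite ?sub0v ?capv0 //; exact: ideal_of0.
elim: n U => // n IH U dimU idU sUA WU0.
have sWUA : (W + U <= asoc L)%VS by rewrite subv_add sWA.
have [WUA|/eqP nWUA] := eqVneq (W + U)%VS (asoc L); first by exists U.
have [N [minN abN nNWU]] : exists N,
    [/\ minimal_ideal N, abelian N & ~ (N <= W + U)%VS].
  apply: contrapT => noN; apply: nWUA; apply/eqP; rewrite eqEsubv sWUA /=.
  apply: sumvs_sub => N [minN abN]; apply: contrapT => nN; apply: noN.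
  by exists N.
have sNA : (N <= asoc L)%VS by exact: sumvs_sup.
have [idN N0 minN'] := minN.
have NWU0 : (N :&: (W + U) = 0)%VS.
  have [||//|NE] := minN' (N :&: (W + U))%VS.
  - by apply: ideal_ofI => //; exact: ideal_ofD.
  - exact: capvSl.
  by case: nNWU; rewrite -NE capvSr.
apply: (IH (U + N)%VS).
- rewrite -ltnS (leq_trans _ dimU) // ltnS ltn_sub2l //.
    rewrite ltnNge; apply/negP => dimAU; apply: nNWU.
    have /eqP -> : (U == asoc L)%VS by rewrite eqEdim sUA.
    by rewrite (subv_trans sNA) ?addvSr.
  rewrite dimv_disjoint_sum; last first.
    apply/eqP; rewrite -subv0 -NWU0 capvC capvS ?addvSr //.
  by rewrite -addn1 leq_add2l lt0n dimv_eq0; apply/eqP.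
- exact: ideal_ofD.
- by rewrite subv_add sUA.
apply/eqP; rewrite -subv0; apply/subvP=> w; rewrite memv_cap => /andP[wW].
case/memv_addP=> u uU [v vN wE].
have : v \in (N :&: (W + U))%VS.
  rewrite memv_cap vN (_ : v = w - u); last by rewrite wE addrC addKr.
  by rewrite memv_add // memvN.
rewrite NWU0 memv0 => /eqP v0; rewrite -WU0 memv_cap wW.
by rewrite wE v0 addr0.
Qed.

End Asoc.

(** * Heisenberg algebras *)

Section Heisenberg.
Context {F : fieldType} {L : lieAlgType F}.
Implicit Types (x y z : L) (S T U V W I J M N A B C : {vspace L}).

(** Substituting a dependence for [x] or for [y] in [[lie x, y]] makes this bracket vanish. *)
Lemma heisenberg_free x y : [lie x, y] != 0 -> [lie x, [lie x, y]] = 0 ->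
  [lie y, [lie x, y]] = 0 -> free [:: x; y; [lie x, y]].
Proof.
set z := [lie x, y] => z0 xz yz.
rewrite !free_cons nil_free andbT span_nil memv0 z0 andbT.
rewrite !span_cons span_nil addv0; apply/andP; split; apply/negP.
  case/memv_addP=> _ /vlineP[b ->] [_ /vlineP[c ->] xE].
  move/negP: z0; apply; apply/eqP; rewrite /z {1}xE lieDl !lieZl liexx.
  by rewrite lieC yz oppr0 !scaler0 addr0.
case/vlineP=> c yE; move/negP: z0; apply; apply/eqP.
by rewrite /z {1}yE lieZr xz scaler0.
Qed.

Lemma heisenberg_subalgebra x y z : [lie x, y] = z -> [lie x, z] = 0 ->
  [lie y, z] = 0 ->
  subalgebra <<[:: x; y; z]>>%VS /\
  {in <<[:: x; y; z]>>%VS & &, forall u v w, [lie u, [lie v, w]] = 0}.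
Proof.
move=> xy xz yz; set T := <<_>>%VS.
have zT : z \in T by rewrite memv_span // !inE eqxx !orbT.
have TE u : u \in T -> exists a b c, u = a *: x + (b *: y + c *: z).
  rewrite /T !span_cons span_nil addv0.
  case/memv_addP=> _ /vlineP[a ->] [w + ->].
  case/memv_addP=> _ /vlineP[b ->] [_ /vlineP[c ->] ->].
  by exists a, b, c.
have zC u : u \in T -> [lie u, z] = 0.
  by case/TE=> a [b [c ->]]; rewrite !lieDl !lieZl xz yz liexx !scaler0 !addr0.
have TT u v : u \in T -> v \in T -> exists k, [lie u, v] = k *: z.
  move=> /TE[a [b [c uE]]] vT; have [a' [b' [c' vE]]] := TE v vT.
  exists (a * b' - b * a').
  rewrite uE !lieDl !lieZl (lieC z) zC // oppr0 scaler0 addr0 vE.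
  rewrite !lieDr !lieZr xz yz !liexx xy (lieC y x) xy !scaler0 !addr0 add0r.
  by rewrite !scalerN !scalerA scalerBl.
split.
  apply/subalgebraP=> u v uT vT; have [k ->] := TT u v uT vT.
  exact: memvZ.
by move=> u v w uT vT wT; have [k ->] := TT v w vT wT; rewrite lieZr zC ?scaler0.
Qed.

(** A non-abelian subalgebra contains some independent [u], [v], [[lie u, v]], so it has dimension
    3; proper subalgebras are therefore abelian. *)
Lemma heisenberg3_minimal_non_elementary : heisenberg3 L ->
  frattini_ideal (fullv : {vspace L}) <> 0%VS /\
  (forall S, subalgebra S -> S <> fullv -> frattini_ideal S = 0%VS).
Proof.
case=> x [y [z [bas xy xz yz]]].
have [_] := heisenberg_subalgebra xy xz yz; rewrite (span_basis bas) => cl2.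
have z0 : z != 0 by rewrite (basis_not0 bas) // !inE eqxx !orbT.
split.
  apply: class2_frattini_ideal_neq0 cl2 _; first exact: subalgebra_full.
  apply/negP => /abelianP/(_ x y (memvf _) (memvf _)); rewrite xy => /eqP.
  by rewrite (negPf z0).
move=> S saS nS; apply: abelian_frattini_ideal0; apply: contrapT => /negP nab.
apply: nS; have [u [v [uS vS uv0]]] : exists u v,
    [/\ u \in S, v \in S & [lie u, v] != 0].
  apply: contrapT => nouv; move/negP: nab; apply; apply/abelianP=> u v uS vS.
  by apply: contrapT => /eqP uv; apply: nouv; exists u, v.
have fr : free [:: u; v; [lie u, v]].
  by apply: heisenberg_free; rewrite ?cl2 ?memvf.
apply/eqP; rewrite eqEdim subvf.
rewrite -(span_basis bas) (eqP (basis_free bas)) /=.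
rewrite -[3%N]/(size [:: u; v; [lie u, v]]) -(eqP fr) dimvS //.
apply/span_subvP=> w; rewrite !inE => /or3P[] /eqP -> //.
exact: (subalgebraP _ saS).
Qed.

Lemma heisenberg3_of_class2 :
  (forall S, subalgebra S -> S <> fullv -> frattini_ideal S = 0%VS) ->
  ~~ abelian (fullv : {vspace L}) ->
  (forall x y z, [lie x, [lie y, z]] = 0) -> heisenberg3 L.
Proof.
move=> phi0 nab cl2.
have [x [y xy0]] : exists x y, [lie x, y] != 0.
  apply: contrapT => noxy; move/negP: nab; apply; apply/abelianP=> u v _ _.
  by apply: contrapT => /eqP uv; apply: noxy; exists u, v.
exists x, y, [lie x, y]; split; rewrite ?cl2 //.
have [saT T2] := heisenberg_subalgebra (erefl [lie x, y]) (cl2 _ _ _) (cl2 _ _ _).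
rewrite /basis_of heisenberg_free ?cl2 // andbT; apply/eqP.
apply: contrapT => nT; apply: class2_frattini_ideal_neq0 saT T2 _ (phi0 _ saT nT).
apply/negP => /abelianP/(_ x y); rewrite !memv_span ?inE ?eqxx ?orbT //.
by move=> /(_ isT isT) /eqP; rewrite (negPf xy0).
Qed.

End Heisenberg.

(** * Abelian derived algebras *)

Section LineCase.
Context {F : fieldType} {L : lieAlgType F}.
Implicit Types (x y z : L) (S T U V W I J M N B C : {vspace L}).
Local Notation A := (derived_algebra L).

(** Subalgebras of a proper subalgebra are proper, so the nested quantification over subalgebras
    collapses. *)
Lemma minimal_non_elementaryE : minimal_non_elementary L <->
  frattini_ideal (fullv : {vspace L}) <> 0%VS /\
  (forall S, subalgebra S -> S <> fullv -> frattini_ideal S = 0%VS).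
Proof.
split=> [[nel elS]|[phi phi0]]; last first.
  split=> [el|S saS nS T saT sTS].
    by apply: phi; apply: el => //; exact: subalgebra_full.
  apply: phi0 => // TL; apply: nS; apply/eqP.
  by rewrite eqEsubv subvf -TL.
have phi0 S : subalgebra S -> S <> fullv -> frattini_ideal S = 0%VS.
  by move=> saS nS; apply: (elS S saS nS S saS).
split=> // phi; apply: nel => T saT _.
by have [->|/eqP nT] := eqVneq T fullv; [|exact: phi0].
Qed.

Lemma derived_ideal : ideal A.
Proof. exact: ideal_of_lie (ideal_of_refl subalgebra_full). Qed.

Lemma disjoint_line V x : x \notin V -> (V :&: <[x]> = 0)%VS.
Proof.
move=> nxV; apply/eqP; rewrite -subv0; apply/subvP=> v; rewrite memv_cap.
case/andP=> + /vlineP[k vE]; rewrite vE memv0 => kxV.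
have [->|k0] := eqVneq k 0; first by rewrite scale0r.
by case/negP: nxV; rewrite -[x](scalerK k0) memvZ.
Qed.

Hypothesis abA : abelian A.

Lemma derived_stable x : stable (ad x) A.
Proof. exact: ideal_of_stable derived_ideal (memvf x). Qed.

Lemma line_ideal x W : (A + <[x]> = fullv)%VS -> (W <= A)%VS ->
  stable (ad x) W -> ideal W.
Proof. by rewrite /ideal => <-; apply: ideal_of_line. Qed.

Lemma line_ad_surj x : (A + <[x]> = fullv)%VS -> (ad x @: A = A)%VS.
Proof.
move=> AxL; apply/eqP; rewrite eqEsubv; apply/andP; split; first exact: derived_stable.
by have := liev_sub_abelian_line abA (derived_stable x); rewrite AxL.
Qed.

Lemma line_ad_inj x : (A + <[x]> = fullv)%VS -> (A :&: lker (ad x) = 0)%VS.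
Proof.
move=> AxL; apply/eqP; rewrite -dimv_eq0 -(eqn_add2r (\dim A)) add0n.
by rewrite -[X in (_ + \dim X)%N](line_ad_surj AxL) limg_ker_dim.
Qed.

(** Injectivity of [ad x] on [A] leaves only a multiple of [x]; if that were nonzero, [x] would be
    central and [A], the image of [ad x], would be zero. *)
Lemma line_center0 x v : (A + <[x]> = fullv)%VS ->
  ~~ abelian (fullv : {vspace L}) -> (forall y, [lie y, v] = 0) -> v = 0.
Proof.
move=> AxL nab cv; have := memvf v; rewrite -AxL.
case/memv_addP=> a aA [_ /vlineP[c ->] vE].
have xa : [lie x, a] = 0.
  by have := cv x; rewrite vE lieDr lieZr liexx scaler0 addr0.
have a0 : a = 0.
  by apply/eqP; rewrite -memv0 -(line_ad_inj AxL) memv_cap aA memv_ker adE xa /=.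
rewrite vE a0 add0r; have [->|c0] := eqVneq c 0; first by rewrite scale0r.
case/negP: nab; rewrite /abelian -[liev _ _](line_ad_surj AxL) -lkerE.
apply/subvP=> y _; rewrite memv_ker adE -[x](scalerK c0) lieZl lieC.
by have := cv y; rewrite vE a0 add0r => ->; rewrite oppr0 scaler0.
Qed.

(** * Direct implication when a line supplements the derived algebra *)

Section Forward.
Hypothesis phiL : frattini_ideal (fullv : {vspace L}) <> 0%VS.
Hypothesis phi0 : forall S, subalgebra S -> S <> fullv -> frattini_ideal S = 0%VS.
Variable x : L.
Hypothesis AxL : (A + <[x]> = fullv)%VS.

Let nabL : ~~ abelian (fullv : {vspace L}).
Proof. by apply/negP => /abelian_frattini_ideal0. Qed.

Lemma line_notin : x \notin A.
Proof.
apply/negP=> xA; move/negP: nabL; apply; rewrite -AxL.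
by have /addv_idPl -> : (<[x]> <= A)%VS.
Qed.

(** [I + <[x]>] is proper, so [I] is completely reducible under [ad x]; stable subspaces of [A] are
    ideals of [L]. *)
Lemma proper_ideal_sub_asoc I : ideal I -> (I <= A)%VS -> I <> A -> (I <= asoc L)%VS.
Proof.
move=> idI sIA nIA; have abI := abelianS sIA abA.
have xI := ideal_of_stable idI (memvf x).
apply: completely_reducible_sub_asoc => //.
have saT := subalgebra_line abI xI.
have nT : (I + <[x]>)%VS <> fullv.
  move=> IxL; apply: nIA.
  by rewrite -[RHS]capfv -IxL -vspace_modl // capvC disjoint_line ?addv0 ?line_notin.
have crI := completely_reducible_abelian_ideal saT (phi0 saT nT)
  (ideal_of_line abI (subvv I) xI) abI.
move=> W idW sWI.
have [|U [idU WUI WU0]] := crI W _ sWI.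
  by apply: ideal_of_line => //; exact: ideal_of_stable idW (memvf x).
exists U; split=> //; apply: (line_ideal AxL).
  by rewrite (subv_trans _ sIA) // -WUI addvSr.
by apply: ideal_of_stable idU _; rewrite (subvP (addvSr _ _)) ?memv_line.
Qed.

(** A minimal ideal meeting [A] trivially would be central, hence zero. *)
Lemma asoc_sub_derived : (asoc L <= A)%VS.
Proof.
apply: sumvs_sub => N [[idN N0 minN] _].
have [||NA0|NA] := minN (N :&: A)%VS.
- exact: ideal_ofI derived_ideal.
- exact: capvSl.
- case: N0; apply/eqP; rewrite -subv0; apply/subvP=> v vN; rewrite memv0.
  apply/eqP; apply: (line_center0 AxL) => // y; apply/eqP.
  have [_ idN'] := ideal_ofP _ _ idN.
  by rewrite -memv0 -NA0 memv_cap idN' ?memv_lie ?memvf.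
by rewrite -NA capvSr.
Qed.

Lemma line_frattini_ideal0 : completely_reducible fullv A ->
  frattini_ideal (fullv : {vspace L}) = 0%VS.
Proof.
move=> crA; apply: (@frattini_ideal_split _ _ _ <[x]> A) => //.
- exact: subalgebra_full.
- exact: abelian_subalgebra (abelian_line x).
- exact: derived_ideal.
- by rewrite addvC.
- by rewrite capvC disjoint_line ?line_notin.
- exact: abelian_frattini_ideal0 (abelian_line x).
Qed.

Lemma asoc_neq_derived : asoc L <> A.
Proof.
move=> AE; apply: phiL; apply: line_frattini_ideal0; rewrite -AE.
exact: asoc_completely_reducible.
Qed.

Lemma derived_maximal : maximal_subalgebra_of fullv A.
Proof.
split; first exact: abelian_subalgebra.
- exact: subvf.
- by move=> AL; case/negP: nabL; rewrite -AL.
move=> T saT sAT _; have [/subvP sTA|/subvPn[t tT ntA]] := boolP (T <= A)%VS.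
  by left; apply/eqP; rewrite eqEsubv sAT andbT; exact/subvP.
right; apply/eqP; rewrite eqEsubv subvf /= -AxL subv_add sAT /=.
have := memvf t; rewrite -AxL => /memv_addP[a aA [_ /vlineP[c ->] tE]].
have [c0|c0] := eqVneq c 0.
  by case/negP: ntA; rewrite tE c0 scale0r addr0.
rewrite -memvE -[x](scalerK c0) memvZ // (_ : c *: x = t - a).
  by rewrite memvB // (subvP sAT).
by rewrite tE addrC addKr.
Qed.

Lemma frattini_ideal_asoc : frattini_ideal (fullv : {vspace L}) = asoc L.
Proof.
apply/eqP; rewrite eqEsubv; apply/andP; split.
  apply: proper_ideal_sub_asoc.
  - exact: frattini_idealW.
  - exact: subv_trans (frattini_ideal_sub _) (frattini_sub_max derived_maximal).
  (* If the Frattini ideal were [A], the line [<[x]>] alone would be all of [L]. *)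
  move=> phiA; have nx : <[x]>%VS <> fullv.
    by move=> xL; case/negP: nabL; rewrite -xL; exact: abelian_line.
  apply: nx; apply: (@frattini_nongenerator _ _ _ _ A).
  - exact: subalgebra_full.
  - exact: abelian_subalgebra (abelian_line x).
  - exact: subvf.
  - by rewrite -{1}phiA; exact: frattini_ideal_sub.
  by rewrite AxL.
apply: sub_frattini_ideal; first exact: asoc_ideal.
apply: sub_frattini => [|M [saM _ nM maxM]]; first exact: subvf.
apply: contrapT => nsM.
have nMA : ~ (M <= A)%VS.
  move=> sMA; have [_ _ nA _] := derived_maximal.
  have [|//||AM|//] := maxM A; last by case: nsM; rewrite -AM asoc_sub_derived.
  - exact: abelian_subalgebra.
  - exact: subvf.
have {nMA}/negP/subvPn[t tM ntA] := nMA.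
have AtL : (A + <[t]> = fullv)%VS.
  have [_ _ _ maxA] := derived_maximal.
  have [|||AE|//] := maxA (A + <[t]>)%VS.
  - exact: subalgebra_line abA (derived_stable t).
  - exact: addvSl.
  - exact: subvf.
  by case/negP: ntA; rewrite -AE (subvP (addvSr _ _)) ?memv_line.
have stM : (<[t]> <= M)%VS by rewrite -memvE.
(* With [t] in [M] outside [A], the space [M :&: A] is an ideal of [L], proper in [A]. Then
   [asoc L + M = fullv] would give [A = asoc L] by the modular law. *)
have MAs : (M :&: A <= asoc L)%VS.
  apply: proper_ideal_sub_asoc; last 2 first.
  - exact: capvSr.
  - move=> MA; apply: nM; apply/eqP; rewrite eqEsubv subvf -AtL subv_add stM andbT.
    by rewrite -MA capvSl.
  apply: (line_ideal AtL); first exact: capvSr.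
  apply/stable_adP=> v; rewrite !memv_cap => /andP[vM vA].
  by rewrite (subalgebraP _ saM) // (stable_adP _ _ (derived_stable t)).
have [|||ME|ML] := maxM (asoc L + M)%VS.
- exact: subalgebra_addI (subvf M) saM asoc_ideal.
- exact: addvSr.
- exact: subvf.
- by case: nsM; rewrite -ME addvSl.
apply: asoc_neq_derived; apply/eqP; rewrite eqEsubv asoc_sub_derived /=.
rewrite -[X in (X <= _)%VS]capfv -ML -vspace_modl ?asoc_sub_derived //.
by rewrite subv_add subvv.
Qed.

End Forward.

(** If [S] is not inside [A], some [t] in [S] can replace [x]. Then [S] splits as [<[t]>] plus
    [A :&: S], an ideal of [L] inside the completely reducible socle. *)
Lemma split_line_minimal_non_elementary x : (A + <[x]> = fullv)%VS ->
    (forall I, ideal I -> (I <= A)%VS -> I <> A -> (I <= asoc L)%VS) ->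
  forall S, subalgebra S -> S <> fullv -> frattini_ideal S = 0%VS.
Proof.
move=> AxL bigI S saS nS.
have [sSA|/subvPn[t tS ntA]] := boolP (S <= A)%VS.
  exact: abelian_frattini_ideal0 (abelianS sSA abA).
have AtL : (A + <[t]> = fullv)%VS.
  apply/eqP; rewrite eqEsubv subvf /= -{1}AxL subv_add addvSl /=.
  have := memvf t; rewrite -{1}AxL => /memv_addP[a aA [_ /vlineP[c ->] tE]].
  have [c0|c0] := eqVneq c 0.
    by case/negP: ntA; rewrite tE c0 scale0r addr0.
  rewrite -memvE -[x](scalerK c0) memvZ // (_ : c *: x = - a + t).
    by rewrite memv_add ?memvN ?memv_line.
  by rewrite tE addKr.
have stS : (<[t]> <= S)%VS by rewrite -memvE.
have idV : ideal (A :&: S).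
  apply: (line_ideal AtL); first exact: capvSl.
  apply/stable_adP=> v; rewrite !memv_cap => /andP[vA vS].
  by rewrite (subalgebraP _ saS) // (stable_adP _ _ (derived_stable t)).
have nVA : (A :&: S)%VS <> A.
  move/capv_idPl=> sAS; apply: nS; apply/eqP.
  by rewrite eqEsubv subvf -AtL subv_add sAS.
have crV : completely_reducible fullv (A :&: S)%VS.
  apply: completely_reducibleS idV (bigI _ idV (capvSl _ _) nVA).
  exact: asoc_completely_reducible.
apply: (@frattini_ideal_split _ _ _ <[t]> (A :&: S)%VS) => //.
- exact: abelian_subalgebra (abelian_line t).
- exact: ideal_of_restr (subvf S) (capvSr _ _) idV.
- by rewrite vspace_modl // addvC AtL capfv.
- by rewrite capvC disjoint_line // memv_cap (negPf ntA).
- exact: abelian_frattini_ideal0 (abelian_line t).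
move=> W idW sWV; have sWA := subv_trans sWV (capvSl _ _).
have [|U [idU WUV WU0]] := crV W _ sWV.
  exact: line_ideal AtL sWA (ideal_of_stable idW tS).
exists U; split=> //; apply: ideal_of_restr (subvf S) _ idU.
by rewrite (subv_trans _ (capvSr A S)) // -WUV addvSr.
Qed.

(** Averaging makes [A] completely reducible. If some [ad x] is nonzero on [A], a Fitting-type
    splitting for [ad x] forces the Frattini ideal to vanish; otherwise [L] has class 2. *)
Lemma no_line_heisenberg3 : perfect_field F ->
    frattini_ideal (fullv : {vspace L}) <> 0%VS ->
    (forall S, subalgebra S -> S <> fullv -> frattini_ideal S = 0%VS) ->
    (forall x, (A + <[x]>)%VS <> fullv) ->
  heisenberg3 L.
Proof.
move=> perfF phiL phi0 noline.
have sepA x : separable_on (ad x) A.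
  apply: separable_ad => //; first exact: derived_stable.
  by apply: phi0 => //; exact: subalgebra_line abA (derived_stable x).
have comA x y : {in A, forall a, [lie x, [lie y, a]] = [lie y, [lie x, a]] }.
  move=> a aA; rewrite lie_leibniz (abelianP _ abA) ?add0r //.
  by rewrite memv_lie ?memvf.
have crA : completely_reducible fullv A.
  move=> W idW sWA.
  have [|||U [Ust WUA WU0]] :=
      @commuting_separable_complement _ _ (map ad (vbasis {:L})) A W.
  - by [].
  - move=> _ /mapP[x _ ->]; split; [exact: derived_stable| |exact: sepA].
    exact: ideal_of_stable idW (memvf x).
  - by move=> _ _ /mapP[x _ ->] /mapP[y _ ->] a aA; rewrite !adE comA.
  exists U; split=> //; apply/ideal_ofP; split=> [|s u _ uU]; first exact: subvf.
  (* The elements sending [u] into [U] form a subspace, so basis elements suffice. *)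
  suff /subvP/(_ s (memvf s)) : (fullv <= linfun (lie_bracketr u) @^-1: U)%VS.
    by rewrite -memv_preim lfunE.
  rewrite -(span_basis (vbasisP {:L})); apply/span_subvP=> x xb.
  by rewrite -memv_preim lfunE /= /lie_bracketr -adE (stableP (Ust _ (map_f _ xb))).
apply: heisenberg3_of_class2 => //.
  by apply/negP=> /abelian_frattini_ideal0.
move=> x y z; apply: contrapT => xyz0.
pose K := (A :&: lker (ad x))%VS.
have idK : ideal K.
  apply/ideal_ofP; split=> [|s k _]; first exact: subvf.
  rewrite !memv_cap !memv_ker !adE => /andP[kA /eqP xk].
  by rewrite (stable_adP _ _ (derived_stable s)) // comA // xk lie0r eqxx.
have [V [idV KVA KV0]] := crA K idK (capvSl _ _).
have sVA : (V <= A)%VS by rewrite -KVA addvSr.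
have Vinj : (V :&: lker (ad x) = 0)%VS.
  apply/eqP; rewrite -subv0 -KV0 !subv_cap capvSl capvSr.
  by rewrite (subv_trans (capvSl _ _) sVA).
have xV : (ad x @: V = V)%VS.
  apply/eqP; rewrite eqEdim limg_dim_eq // leqnn andbT.
  exact: ideal_of_stable idV (memvf x).
(* The square is what allows [U + V = fullv]: [ad x] maps into [A = K + V] and kills [K]. *)
pose U := lker (ad x \o ad x)%VF.
have memU u : u \in U -> [lie x, [lie x, u]] = 0.
  by rewrite memv_ker comp_lfunE !adE => /eqP.
(* By the Leibniz rule only [[lie [lie x, u], [lie x, v]]] could survive, and it is a bracket of two
   elements of the abelian [A]. *)
have saU : subalgebra U.
  apply/subalgebraP=> u v /memU xu /memU xv.
  have xuxv : [lie [lie x, u], [lie x, v]] = 0.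
    by apply: (abelianP _ abA); rewrite memv_lie ?memvf.
  rewrite memv_ker comp_lfunE !adE (lie_leibniz x u) lieDr.
  rewrite (lie_leibniz x [lie x, u]) (lie_leibniz x u [lie x, v]) xu xv xuxv.
  by rewrite lie0l lie0r !addr0.
have UV0 : (U :&: V = 0)%VS.
  apply/eqP; rewrite -subv0; apply/subvP=> v; rewrite memv_cap => /andP[vU vV].
  have xv0 : ad x v \in (V :&: lker (ad x))%VS.
    rewrite memv_cap (stableP (ideal_of_stable idV (memvf x))) //=.
    by rewrite memv_ker !adE memU.
  by rewrite -Vinj memv_cap vV memv_ker -memv0 -Vinj.
have UVL : (U + V = fullv)%VS.
  apply/eqP; rewrite eqEsubv subvf; apply/subvP=> l _.
  have : [lie x, l] \in A by rewrite memv_lie ?memvf.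
  rewrite -KVA -{1}xV => /memv_addP[k kK [_ /memv_imgP[v vV ->] xl]].
  rewrite -(subrK v l) memv_add // memv_ker comp_lfunE linearB /= [ad x l]adE xl addrK.
  by move: kK; rewrite memv_cap memv_ker => /andP[].
apply: phiL; apply: (@frattini_ideal_split _ _ _ U V) => //.
- exact: subalgebra_full.
(* If [U] were everything, [V] would be zero and [A = K] would be killed by [ad x]. *)
- apply: phi0 => // UL; apply: xyz0.
  have V0 : V = 0%VS by rewrite -UV0 UL capfv.
  have : [lie y, z] \in A by rewrite memv_lie ?memvf.
  by rewrite -KVA V0 addv0 memv_cap memv_ker adE => /andP[_ /eqP].
exact: completely_reducibleS crA idV sVA.
Qed.

End LineCase.

Theorem theorem2p5 (F : fieldType) (L : lieAlgType F)
    (perfF : perfect_field F) (solL : lie_solvable L) :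
  minimal_non_elementary L <->
  ((exists x : L, x <> 0%R /\ semidirect (derived_algebra L) <[x]>%VS) /\
   abelian (derived_algebra L) /\
   frattini_ideal (fullv : {vspace L}) = asoc L /\
   asoc L <> 0%VS /\
   ideal (asoc L) /\
   (asoc L <= derived_algebra L)%VS /\
   asoc L <> derived_algebra L /\
   (forall I : {vspace L}, ideal I -> (I <= derived_algebra L)%VS ->
      I <> derived_algebra L -> (I <= asoc L)%VS))
  \/ heisenberg3 L.
Proof.
rewrite minimal_non_elementaryE; split=> [[phiL phi0]|].
  have abA := derived_algebra_abelian perfF phi0 solL.
  have [[x AxL]|noline] := pselect (exists x, (derived_algebra L + <[x]> = fullv)%VS);
    last first.
    by right; apply: no_line_heisenberg3 => // x AxL; apply: noline; exists x.
  left; have nxA := line_notin abA phiL AxL.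
  have phiE := frattini_ideal_asoc abA phiL phi0 AxL.
  split; last first.
    do ![split=> //]; first by rewrite -phiE.
    - exact: asoc_ideal.
    - exact: asoc_sub_derived abA phiL x AxL.
    - exact: asoc_neq_derived abA phiL x AxL.
    exact: proper_ideal_sub_asoc abA phiL phi0 x AxL.
  exists x; split; first by move=> x0; rewrite x0 mem0v in nxA.
  split=> //; first exact: derived_ideal.
    exact: abelian_subalgebra (abelian_line x).
  exact: disjoint_line.
case=> [[[x [x0 [_ _ AxL _]]] [abA [phiE [as0 [_ [_ [_ bigI]]]]]]]|].
  by rewrite phiE; split=> //; exact: split_line_minimal_non_elementary abA x AxL bigI.
exact: heisenberg3_minimal_non_elementary.
Qed.
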